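(* Let $\mathcal{H}$ be a Hilbert space and let $A,B\in\mathcal{B}(\mathcal{H})$ be two positive operators such that $\|A\|\mathbf{1}_{\mathcal{H}}\le B$. (1) If $0\le p\le 1$, then $$p\|B\|^{p-1}(B-A)\le B^p-A^p.$$ (2) If $p\ge 1$ or $p\le 0$, then $$B^p-A^p\le p\|B\|^{p-1}(B-A).$$
   Context: $\mathcal{B}(\mathcal{H})$ is the $C^*$-algebra of all bounded linear operators on the Hilbert space $\mathcal{H}$, $\mathbf{1}_{\mathcal{H}}$ is the identity operator on $\mathcal{H}$, and $\|\cdot\|$ is the usual operator norm. For $X,Y\in\mathcal{B}(\mathcal{H})$, $X\le Y$ means that both $X$ and $Y$ are self-adjoint and $Y-X$ is positive; $0\le X$ means that $X$ is positive (positive semidefinite). Here $p$ is a real number, and powers of positive operators are understood in the sense of functional calculus. *)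

(* Defs.v *)
From HB Require Import structures.
From mathcomp Require Import all_boot all_order all_algebra sesquilinear.
From mathcomp Require Import complex.
From mathcomp Require Import all_classical all_reals all_analysis.

Set Implicit Arguments.
Unset Strict Implicit.
Unset Printing Implicit Defensive.

Import Order.TTheory GRing.Theory Num.Theory.
Import numFieldNormedType.Exports.

Local Open Scope classical_set_scope.
Local Open Scope ring_scope.
Local Open Scope complex_scope.

(** A complex Hilbert space: a Banach space over [R[i]] whose norm comes from
    an inner product, linear in its first argument and conjugate-linear in the
    second one. *)
HB.mixin Record CompleteNormedModule_isHilbert (R : realType) H
    of CompleteNormedModule R[i] H := {
  inner : {dot H for Num.conj} ;
  inner_norm : forall x : H, inner x x = `|x| ^+ 2
}.

#[short(type="hilbertType")]
HB.structure Definition Hilbert (R : realType) :=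
  { H of CompleteNormedModule_isHilbert R H & CompleteNormedModule R[i] H }.

Section Operators.
Context {R : realType} {H : hilbertType R}.
Implicit Types (S T X Y : H -> H).

(** Operators are elements of the [R[i]]-module of all functions [H -> H];
    this is the subset B(H). The norm of [H] takes its (real) values
    in [R[i]]. *)
Definition bounded_operator T : Prop :=
  linear T /\ exists M : R, forall x : H, `|T x| <= M%:C * `|x|.

Definition opnorm T : R :=
  sup [set complex.Re `|T x| | x in [set x : H | `|x| <= 1]].

Definition self_adjoint T : Prop :=
  bounded_operator T /\ forall x y : H, inner (T x) y = inner x (T y).

(** In [R[i]], [0 <= z] says that [z] is real and nonnegative. *)
Definition positive_operator T : Prop :=
  self_adjoint T /\ forall x : H, 0 <= inner (T x) x.

Definition operator_le X Y : Prop :=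
  [/\ self_adjoint X, self_adjoint Y & positive_operator (Y - X)].

Definition invertible_operator T : Prop :=
  exists S, [/\ bounded_operator S, cancel T S & cancel S T].

Definition spectrum T : set R[i] :=
  [set z | ~ invertible_operator (z *: (idfun : H -> H) - T)].

Definition poly_operator (q : {poly R}) T : H -> H :=
  \sum_(i < size q) (q`_i)%:C *: (iter i T : H -> H).

(** [S] is f(T): the operator-norm limit of q_n(T) for real polynomials q_n
    converging to f uniformly on the spectrum of [T]. This is meant for
    self-adjoint [T], whose spectrum is real, and for f continuous on the
    spectrum; [S] then exists, is unique, and does not depend on the q_n. *)
Definition is_funcalc T (f : R -> R) S : Prop :=
  bounded_operator S /\
  exists q : nat -> {poly R},
    {uniform [set t : R | spectrum T t%:C],
       (fun n (t : R) => (q n).[t]) @ \oo --> f} /\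
    (fun n => opnorm (poly_operator (q n) T - S)) @ \oo --> (0 : R).

Definition funcalc T (f : R -> R) : H -> H := xget 0 (is_funcalc T f).

(** [powR] satisfies [0 `^ 0 = 1] and [0 `^ p = 0] for [p != 0], so the power
    [0] of a positive operator is the identity; for [p < 0] the power is
    meaningful when [T] is invertible. *)
Definition operator_pow T (p : R) : H -> H := funcalc T (fun t => t `^ p).

End Operators.

(* Main.v *)
Require Import Defs.
From HB Require Import structures.
From mathcomp Require Import all_boot all_order all_algebra sesquilinear.
From mathcomp Require Import complex.
From mathcomp Require Import all_classical all_reals all_analysis.
From mathcomp Require Import ring lra.

(** Write a and b for the norms of A and B, and k = p b^(p-1), the slope of
    t^p at t = b. On the part of [0, b] where t^p makes sense, the derivative
    p t^(p-1) of the power lies above k when 0 <= p <= 1, and below k when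
    p >= 1 or p <= 0. So t^p - k t is monotone on that interval: increasing in
    the first case, decreasing in the second one. The spectrum of A lies in
    [0, a] and the spectrum of B lies in [a, b], so the number
    c = a^p - k a separates the values of t^p - k t on the two spectra. The
    functional calculus turns this into
      A^p - k A <= c 1 <= B^p - k B   when 0 <= p <= 1,
    and into the reversed inequalities when p >= 1 or p <= 0. Subtracting
    them proves both claims.

    The scalar monotonicity is the mean value theorem
    ([powR_increment_ge], [powR_increment_le]). The rest of the work is to
    show that the functional calculus exists and is monotone.

    - Invertibility comes from a coercivity criterion, [lax_milgram]. It
      shows that the spectrum of a self-adjoint operator is real and lies
      between any two numbers that bound its quadratic form
      ([sa_spectrum_real], [spectrum_ge], [spectrum_le]).
    - The best lower bound of the quadratic form of a self-adjoint operator
      belongs to its spectrum ([sa_lower_bound_in_spectrum]). Since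
      q(T) - m is a product of factors T - z over the roots z of q - m, every
      point m of the spectrum of q(T) is a value of q on the spectrum of T.
      Together these give the order estimate [spectral_lower]: if q >= c on
      the spectrum of T, then q(T) >= c. The norm estimate [spectral_norm]
      follows by applying it to e^2 - q^2.
    - By these estimates, polynomials that approximate f on the spectrum of
      T produce a Cauchy sequence of operators, so f(T) exists
      ([funcalc_exists]), and polynomial bounds for f pass to f(T)
      ([funcalc_ge_poly]). The approximation of powers by polynomials is
      Bernstein's proof of the Weierstrass theorem ([lipschitz_approx]). *)

Set Implicit Arguments.
Unset Strict Implicit.
Unset Printing Implicit Defensive.

Import Order.TTheory GRing.Theory Num.Theory.
Import numFieldNormedType.Exports.

Local Open Scope classical_set_scope.
Local Open Scope ring_scope.
Local Open Scope complex_scope.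

(** * Bernstein approximation *)

Section Bernstein.
Context {R : realType}.
Implicit Types (u v : nat -> R) (x y : R).

(** The value at x in [0, 1] is the mean of [u] at a binomial variable, the
    number of successes in [n] independent trials of probability x.
    Conditioning on one trial gives this recursion, which avoids binomial
    coefficients. *)
Fixpoint bernstein n u : {poly R} :=
  if n is n'.+1 then
    'X * bernstein n' (fun k => u k.+1) + (1 - 'X) * bernstein n' u
  else (u 0%N)%:P.

Lemma bernsteinS n u x : (bernstein n.+1 u).[x] =
  x * (bernstein n (fun k => u k.+1)).[x] + (1 - x) * (bernstein n u).[x].
Proof. by rewrite /= !hornerE. Qed.

Lemma bernstein_dist n u v c x : 0 <= x <= 1 ->
  (forall k, (k <= n)%N -> `|u k - c| <= v k) ->
  `|(bernstein n u).[x] - c| <= (bernstein n v).[x].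
Proof.
move=> x01; elim: n u v => [|n IH] u v h; first by rewrite /= !hornerC h.
rewrite !bernsteinS.
have h1 := IH (fun k => u k.+1) (fun k => v k.+1) (fun k kn => h k.+1 kn).
have h2 := IH u v (fun k kn => h k (leqW kn)).
move: h1 h2; set b1 := (bernstein n _).[x]; set b2 := (bernstein n u).[x].
move=> h1 h2.
have -> : x * b1 + (1 - x) * b2 - c = x * (b1 - c) + (1 - x) * (b2 - c) by ring.
case/andP: x01 => x0 x1; have x1' : 0 <= 1 - x by rewrite subr_ge0.
apply: le_trans (ler_normD _ _) _.
by rewrite !normrM (ger0_norm x0) (ger0_norm x1') lerD // ler_wpM2l.
Qed.

(** For a = 0, b = 1 and y = n x this is the variance n x (1 - x) of the
    binomial law; the induction on [n] needs an arbitrary centre [y]. *)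
Lemma bernstein_moments n (a b y x : R) :
  (bernstein n (fun k => a + b * (k%:R - y) ^+ 2)).[x] =
  a + b * ((n%:R * x - y) ^+ 2 + n%:R * (x * (1 - x))).
Proof.
elim: n y => [|n IH] y; first by rewrite /= hornerC; ring.
rewrite bernsteinS IH.
have -> : (fun k => a + b * (k.+1%:R - y) ^+ 2) =
    (fun k => a + b * (k%:R - (y - 1)) ^+ 2).
  by apply/funext => k; rewrite -natr1; ring.
by rewrite IH -natr1; ring.
Qed.

(** Bernstein's argument: by the inequality between the means, K |d| is at
    most e/2 + K^2 d^2 / (2 e), so the error is bounded by e/2 plus a multiple
    of the variance of k/n, which is at most 1/n. *)
Lemma lipschitz_approx (f : R -> R) (K : R) : 0 <= K ->
  (forall x y, 0 <= x <= 1 -> 0 <= y <= 1 -> `|f x - f y| <= K * `|x - y|) ->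
  forall e : R, 0 < e -> exists q : {poly R}, forall x, 0 <= x <= 1 ->
    `|f x - q.[x]| <= e.
Proof.
move=> K0 lipf e e0.
pose n := (Num.truncn (K ^+ 2 / e ^+ 2)).+1.
have n0 : 0 < n%:R :> R by rewrite ltr0n.
have hn : K ^+ 2 < n%:R * e ^+ 2.
  rewrite -ltr_pdivrMr ?exprn_gt0 //; exact: truncnS_gt.
exists (bernstein n (fun k => f (k%:R / n%:R))) => x x01; rewrite distrC.
pose b := K ^+ 2 / (2 * e * n%:R ^+ 2).
pose v k := e / 2 + b * (k%:R - n%:R * x) ^+ 2.
apply: (@le_trans _ _ (bernstein n v).[x]).
  apply: bernstein_dist => // k kn; rewrite /v.
  have k01 : 0 <= (k%:R / n%:R : R) <= 1.
    by rewrite divr_ge0 ?ler0n //= ler_pdivrMr // mul1r ler_nat.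
  apply: le_trans (lipf _ _ k01 x01) _.
  set d := k%:R / n%:R - x.
  have -> : k%:R - n%:R * x = n%:R * d.
    by rewrite mulrBr mulrCA divff ?mulr1 // gt_eqF.
  have -> : b * (n%:R * d) ^+ 2 = K ^+ 2 * `|d| ^+ 2 / (2 * e).
    rewrite real_normK ?num_real // /b; field.
    by rewrite gt_eqF //=; exact: lt0r_neq0.
  have -> : e / 2 + K ^+ 2 * `|d| ^+ 2 / (2 * e) =
      (e ^+ 2 + (K * `|d|) ^+ 2) / (2 * e).
    by rewrite exprMn; field; rewrite gt_eqF.
  rewrite ler_pdivlMr; last by rewrite mulr_gt0.
  by have := sqr_ge0 (e - K * `|d|); lra.
rewrite bernstein_moments subrr expr0n add0r.
have x4 : x * (1 - x) <= 1 by case/andP: x01 => x0 x1; nra.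
have en0 : 0 < 2 * e * n%:R ^+ 2 by rewrite !mulr_gt0 // exprn_gt0.
have b0 : 0 <= b by rewrite divr_ge0 ?exprn_ge0 // ltW.
have hb : b * n%:R <= e / 2.
  have -> : b * n%:R = K ^+ 2 / (2 * e * n%:R).
    by rewrite /b; field; rewrite !gt_eqF.
  rewrite ler_pdivrMr ?mulr_gt0 //.
  have -> : e / 2 * (2 * e * n%:R) = n%:R * e ^+ 2 by field.
  exact: ltW.
have : b * (n%:R * (x * (1 - x))) <= b * n%:R.
  by rewrite ler_wpM2l // ler_piMr // ltW.
rewrite /=; lra.
Qed.

End Bernstein.

(** * Real powers *)

Section Powers.
Context {R : realType}.
Implicit Types (p r s t x d e b L : R).

Lemma ler_powR_pos r s t : 0 <= r -> 0 < s -> s <= t -> s `^ r <= t `^ r.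
Proof.
move=> r0 s0 st; apply: ge0_ler_powR => //; rewrite nnegrE ltW //.
exact: lt_le_trans st.
Qed.

Lemma ger_powR_neg r s t : r <= 0 -> 0 < s -> s <= t -> t `^ r <= s `^ r.
Proof.
move=> r0 s0 st; have t0 : 0 < t by exact: lt_le_trans st.
rewrite -[r]opprK !(powRN _ (- r)) lef_pV2 ?posrE ?powR_gt0 //.
by rewrite ler_powR_pos // oppr_ge0.
Qed.

Lemma powR_mvt p s t : 0 < s -> s <= t ->
  exists2 c, s <= c <= t & t `^ p - s `^ p = p * c `^ (p - 1) * (t - s).
Proof.
move=> s0 st.
have dp c : s <= c -> is_derive c 1 (fun a => a `^ p) (p * c `^ (p - 1)).
  by move=> sc; apply: is_derive1_powR; exact: lt_le_trans sc.
have [||c] :=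
  @MVT_segment R (fun a => a `^ p) (fun c => p * c `^ (p - 1)) s t st.
- by move=> c; rewrite in_itv => /andP[/ltW /dp].
- apply: derivable_within_continuous => c; rewrite in_itv => /andP[/dp h _].
  exact: ex_derive.
- by rewrite in_itv => sct ->; exists c.
Qed.

Lemma powR_lipschitz p d L : 0 < d -> exists2 K : R, 0 <= K &
  forall s t, d <= s <= L -> d <= t <= L -> `|t `^ p - s `^ p| <= K * `|t - s|.
Proof.
move=> d0; exists (`|p| * (d `^ (p - 1) + L `^ (p - 1))).
  by rewrite mulr_ge0 // addr_ge0 ?powR_ge0.
move=> s t; wlog st : s t / s <= t.
  move=> h; case: (leP s t) => [/h//|/ltW ts] sL tL.
  by rewrite distrC (distrC t) h.
move=> /andP[ds sL] /andP[dt tL].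
have [c /andP[sc ct] ->] := powR_mvt p (lt_le_trans d0 ds) st.
rewrite !normrM ler_wpM2r // ler_wpM2l // ger0_norm ?powR_ge0 //.
have dc := le_trans ds sc; have cL := le_trans ct tL.
have [p1|/ltW p1] := leP 0 (p - 1).
  by rewrite ler_wpDl ?powR_ge0 // ler_powR_pos // (lt_le_trans d0).
by rewrite ler_wpDr ?powR_ge0 // ger_powR_neg.
Qed.

(** Cutting t off below at [d] keeps the power Lipschitz on [0, L], for
    every exponent. *)
Lemma powR_max_approx p d L e : 0 < d -> 0 < L -> 0 < e ->
  exists q : {poly R},
    forall t, 0 <= t <= L -> `|Num.max t d `^ p - q.[t]| <= e.
Proof.
move=> d0 L0 e0; have [K K0 hK] := powR_lipschitz p (Num.max L d) d0.
pose f x := Num.max (L * x) d `^ p.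
have [||q hq] := @lipschitz_approx R f (K * L) _ _ e e0.
- by rewrite mulr_ge0 // ltW.
- have dom x : 0 <= x <= 1 -> d <= Num.max (L * x) d <= Num.max L d.
    move=> /andP[x0 x1].
    rewrite le_max lexx orbT ge_max !le_max lexx !orbT andbT.
    by rewrite ler_piMr // ltW.
  move=> x y x01 y01; apply: le_trans (hK _ _ (dom y y01) (dom x x01)) _.
  rewrite -mulrA ler_wpM2l // -[in leRHS](gtr0_norm L0) -normrM mulrBr.
  set a := L * x; set b := L * y.
  have h1 := ler_norm (a - b); have h2 := ler_norm (b - a).
  rewrite distrC in h2; rewrite ler_norml /Num.max.
  by case: ltP => ad; case: ltP => bd; apply/andP; split; lra.
exists (q \Po (L^-1 *: 'X)) => t /andP[t0 tL].
have := hq (L^-1 * t); rewrite /f mulVKf ?gt_eqF // horner_comp !hornerE; apply.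
by rewrite mulr_ge0 ?invr_ge0 ?(ltW L0) //= ler_pdivrMl // mulr1.
Qed.

Lemma powR_approx_away0 p d L e : 0 < d -> 0 < e ->
  exists q : {poly R}, forall t, d <= t <= L -> `|t `^ p - q.[t]| <= e.
Proof.
move=> d0 e0; have L0 : 0 < Num.max L d by rewrite lt_max d0 orbT.
have [q hq] := powR_max_approx p d0 L0 e0; exists q => t /andP[dt tL].
have := hq t; rewrite (max_l dt); apply; rewrite le_max tL andbT.
exact: le_trans (ltW d0) dt.
Qed.

(** For [p > 0] the power is not Lipschitz near 0 in general, but cutting it
    off at [d] changes it by at most d^p, which is made equal to e/2. *)
Lemma powR_approx p L e : 0 <= p -> 0 < e ->
  exists q : {poly R}, forall t, 0 <= t <= L -> `|t `^ p - q.[t]| <= e.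
Proof.
rewrite le_eqVlt => /predU1P[<- e0|p0 e0].
  by exists 1%:P => t _; rewrite powRr0 hornerC subrr normr0 ltW.
pose d := (e / 2) `^ p^-1; have e2 : 0 < e / 2 by rewrite divr_gt0.
have d0 : 0 < d by rewrite powR_gt0.
have dp : d `^ p = e / 2.
  by rewrite /d -powRrM mulVf ?gt_eqF // powRr1 // ltW.
have L0 : 0 < Num.max L 1 by rewrite lt_max ltr01 orbT.
have [q hq] := powR_max_approx p d0 L0 e2; exists q => t /andP[t0 tL].
have := hq t; rewrite t0 le_max tL => /(_ isT).
have [td|dt] := leP d t; first lra.
rewrite dp.
have h1 : t `^ p <= e / 2.
  by rewrite -dp ge0_ler_powR ?nnegrE ?(ltW p0) ?(ltW d0) // ltW.
by have h2 := powR_ge0 t p; rewrite !ler_norml; lra.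
Qed.

(** The derivative p t^(p-1) decreases in t, so on the interval it is at least
    its value at [b]. The case [s = 0] is separate because the derivative may
    be infinite there; then t^p = t t^(p-1). *)
Lemma powR_increment_ge p b s t : 0 <= p <= 1 -> 0 <= s -> s <= t -> t <= b ->
  p * b `^ (p - 1) * (t - s) <= t `^ p - s `^ p.
Proof.
move=> /andP[p0 p1] s0 st tb.
have [->|sn] := eqVneq s t; first by rewrite !subrr mulr0.
have t0 : 0 < t by rewrite (le_lt_trans s0) // lt_neqAle sn.
have [sz|sn0] := eqVneq s 0; last first.
  have s_gt0 : 0 < s by rewrite lt_neqAle eq_sym sn0.
  have [c /andP[sc ct] ->] := powR_mvt p s_gt0 st.
  rewrite ler_wpM2r ?subr_ge0 // ler_wpM2l //.
  by apply: ger_powR_neg; rewrite ?subr_le0 ?(lt_le_trans s_gt0) ?(le_trans ct).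
move: p0; rewrite le_eqVlt => /predU1P[<-|p0].
  by rewrite !mul0r !powRr0 subrr.
rewrite sz powR0 ?gt_eqF // !subr0 -(mulr_powRB1 (ltW t0) p0) mulrC ler_pM2l //.
apply: (@le_trans _ _ (b `^ (p - 1))); first by rewrite ler_piMl ?powR_ge0.
by apply: ger_powR_neg; rewrite ?subr_le0.
Qed.

Lemma powR_increment_le p b s t : 1 <= p \/ p <= 0 -> (p < 0 -> 0 < s) ->
  0 <= s -> s <= t -> t <= b ->
  t `^ p - s `^ p <= p * b `^ (p - 1) * (t - s).
Proof.
move=> hp ps s0 st tb.
have [->|sn] := eqVneq s t; first by rewrite !subrr mulr0.
have t0 : 0 < t by rewrite (le_lt_trans s0) // lt_neqAle sn.
have [sz|sn0] := eqVneq s 0; last first.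
  have s_gt0 : 0 < s by rewrite lt_neqAle eq_sym sn0.
  have [c /andP[sc ct] ->] := powR_mvt p s_gt0 st.
  have c0 := lt_le_trans s_gt0 sc; have cb := le_trans ct tb.
  rewrite ler_wpM2r ?subr_ge0 //; case: hp => hp.
    by rewrite ler_wpM2l ?(le_trans ler01) // ler_powR_pos ?subr_ge0.
  by rewrite ler_wnM2l // ger_powR_neg // subr_le0 (le_trans hp).
case: (ltgtP p 0) => [/ps|p0|->]; last by rewrite !mul0r !powRr0 subrr.
  by rewrite sz ltxx.
case: hp => [p1|]; last by rewrite leNgt p0.
rewrite sz powR0 ?gt_eqF // !subr0 -(mulr_powRB1 (ltW t0) p0) mulrC ler_pM2r //.
apply: (@le_trans _ _ (b `^ (p - 1))); last by rewrite ler_peMl ?powR_ge0.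
by rewrite ler_powR_pos ?subr_ge0.
Qed.

End Powers.

(** * Real-valued norm and inner product *)

Section HilbertBasics.
Context {R : realType} {H : hilbertType R}.
Implicit Types (x y z : H) (S T : H -> H).

(** The norm of [H] takes its values in [R[i]]; this is the same number as an
    element of [R], where ordered field reasoning is available. *)
Definition nrm x : R := complex.Re `|x|.
Definition rdot x y : R := complex.Re (inner x y).

Lemma nrmE x : (nrm x)%:C = `|x|.
Proof. by apply: RRe_real; apply: ger0_real. Qed.

Lemma nrm_ge0 x : 0 <= nrm x.
Proof. by rewrite -ler0c nrmE. Qed.

Lemma nrmD x y : nrm (x + y) <= nrm x + nrm y.
Proof. by rewrite -lecR rmorphD /= !nrmE ler_normD. Qed.

Lemma nrmN x : nrm (- x) = nrm x.
Proof. by rewrite /nrm normrN. Qed.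

Lemma nrm_distC x y : nrm (x - y) = nrm (y - x).
Proof. by rewrite /nrm distrC. Qed.

Lemma nrm_dist z x y : nrm (x - y) <= nrm (x - z) + nrm (z - y).
Proof. by rewrite -lecR rmorphD /= !nrmE ler_distD. Qed.

Lemma nrm0 : nrm 0 = 0.
Proof. by rewrite /nrm normr0. Qed.

Lemma nrm_eq0 x : nrm x = 0 -> x = 0.
Proof. by move=> n0; apply/normr0_eq0; rewrite -nrmE n0. Qed.

Lemma nrmZ (a : R[i]) x : nrm (a *: x) = complex.Re `|a| * nrm x.
Proof.
have aR : (complex.Re `|a|)%:C = `|a| by rewrite RRe_real ?ger0_real.
by apply/complexI; rewrite [RHS]rmorphM nrmE normrZ -nrmE -aR.
Qed.

Lemma nrmZr (a : R) x : nrm (a%:C *: x) = `|a| * nrm x.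
Proof. by rewrite nrmZ normc_def /= expr0n /= addr0 sqrtr_sqr. Qed.

Lemma ReD (u v : R[i]) : complex.Re (u + v) = complex.Re u + complex.Re v.
Proof. by case: u v => [a b] [c d]. Qed.

Lemma ReN (u : R[i]) : complex.Re (- u) = - complex.Re u.
Proof. by case: u. Qed.

Lemma ReM (a : R) (u : R[i]) : complex.Re (a%:C * u) = a * complex.Re u.
Proof. by case: u => c d /=; rewrite mul0r subr0. Qed.

Lemma innerC x y : inner x y = (inner y x)^*%C.
Proof. by rewrite hermC /= mul1r. Qed.

Lemma rdotC x y : rdot x y = rdot y x.
Proof. by rewrite /rdot innerC; case: (inner y x). Qed.

Lemma rdotDl x y z : rdot (x + y) z = rdot x z + rdot y z.
Proof. by rewrite /rdot linearDl ReD. Qed.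

Lemma rdotNl x z : rdot (- x) z = - rdot x z.
Proof. by rewrite /rdot linearNl ReN. Qed.

Lemma rdotBl x y z : rdot (x - y) z = rdot x z - rdot y z.
Proof. by rewrite rdotDl rdotNl. Qed.

Lemma rdotZl (a : R) x z : rdot (a%:C *: x) z = a * rdot x z.
Proof. by rewrite /rdot linearZl_LR /= ReM. Qed.

Lemma rdotDr x y z : rdot z (x + y) = rdot z x + rdot z y.
Proof. by rewrite ![rdot z _]rdotC rdotDl. Qed.

Lemma rdotBr x y z : rdot z (x - y) = rdot z x - rdot z y.
Proof. by rewrite ![rdot z _]rdotC rdotBl. Qed.

Lemma rdotZr (a : R) x z : rdot z (a%:C *: x) = a * rdot z x.
Proof. by rewrite ![rdot z _]rdotC rdotZl. Qed.

Lemma rdotxx x : rdot x x = nrm x ^+ 2.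
Proof. by rewrite /rdot inner_norm -nrmE -rmorphXn. Qed.

(** Cauchy-Schwarz, from the norm of |y| x - |x| y. *)
Lemma rdot_le x y : rdot x y <= nrm x * nrm y.
Proof.
have [nx0 ny0] := (nrm_ge0 x, nrm_ge0 y).
have [/nrm_eq0 ->|nx] := eqVneq (nrm x) 0.
  by rewrite /rdot linear0l nrm0 mul0r.
have [/nrm_eq0 ->|ny] := eqVneq (nrm y) 0.
  by rewrite /rdot linear0r nrm0 mulr0.
have p : 0 < nrm x * nrm y by rewrite mulr_gt0 // lt_neqAle eq_sym ?nx ?ny.
have := sqr_ge0 (nrm ((nrm y)%:C *: x - (nrm x)%:C *: y)).
rewrite -rdotxx rdotBl !rdotBr !rdotZl !rdotZr !rdotxx (rdotC y x).
set d := rdot x y => h; rewrite -(ler_pM2l p); nra.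
Qed.

Lemma rdot_abs x y : `|rdot x y| <= nrm x * nrm y.
Proof. by rewrite ler_norml rdot_le lerNl -rdotNl -(nrmN x) rdot_le. Qed.

(** Polarization over the scalars: the factors 1 and -i recover the real and
    the imaginary part of the inner product. *)
Lemma inner_ext x y x' y' :
  (forall a : R[i], rdot (a *: x) y = rdot (a *: x') y') ->
  inner x y = inner x' y'.
Proof.
move=> h; have := h 1; have := h (- 'i)%C; rewrite !scale1r.
rewrite /rdot !linearZl_LR /=.
case: (inner x y) (inner x' y') => [a b] [c d] /=.
by rewrite oppr0 !mul0r !sub0r !mulN1r !opprK => -> ->.
Qed.

Lemma hilbert_complete (u : nat -> H) :
  (forall e : R, 0 < e -> exists N, forall m n, (N <= m)%N -> (N <= n)%N ->
     nrm (u m - u n) <= e) ->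
  exists l, forall e : R, 0 < e -> exists N, forall n, (N <= n)%N ->
     nrm (u n - l) <= e.
Proof.
move=> hu.
have /cauchy_cvgP cu : cauchy (u @ \oo).
  apply/cauchy_ballP => e e0.
  have eR : e = (complex.Re e)%:C by rewrite RRe_real // gtr0_real.
  have e1 : 0 < complex.Re e by rewrite -ltcR -eR.
  have [N hN] := hu (complex.Re e / 2) ltac:(lra).
  near_simpl; exists ([set n | (N <= n)%N], [set n | (N <= n)%N]).
    by split; exists N.
  move=> [m n] [/= Nm Nn]; rewrite -ball_normE /= -nrmE eR ltcR.
  by apply: le_lt_trans (hN _ _ Nm Nn) _; lra.
exists (lim (u @ \oo)) => e e0.
move/cvgrPdist_le: cu => /(_ e%:C); rewrite ltcR => /(_ e0) [N _ hN].
by exists N => n Nn; rewrite -lecR nrmE distrC; apply: hN.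
Qed.

End HilbertBasics.

(** * Bounded operators and coercivity *)

Section Operators.
Context {R : realType} {H : hilbertType R}.
Implicit Types (x y z : H) (S T : H -> H).

Section Linear.
Variable T : H -> H.
Hypothesis linT : linear T.

Lemma lin0 : T 0 = 0.
Proof.
by have := linT (-1) 0 0; rewrite scaleN1r oppr0 addr0 scaleN1r addNr.
Qed.

Lemma linD x y : T (x + y) = T x + T y.
Proof. by rewrite -{1}[x]scale1r linT scale1r. Qed.

Lemma linZ a x : T (a *: x) = a *: T x.
Proof. by rewrite -[a *: x]addr0 linT lin0 addr0. Qed.

Lemma linN x : T (- x) = - T x.
Proof. by rewrite -scaleN1r linZ scaleN1r. Qed.

Lemma linB x y : T (x - y) = T x - T y.
Proof. by rewrite linD linN. Qed.

End Linear.

Lemma boundedP T : bounded_operator T <->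
  linear T /\ exists2 M : R, 0 < M & forall x, nrm (T x) <= M * nrm x.
Proof.
split=> [[lT [M hM]]|[lT [M M0 hM]]]; split=> //; last first.
  by exists M => x; rewrite -!nrmE -rmorphM lecR.
exists (`|M| + 1) => [|x]; first by rewrite ltr_wpDl.
have := hM x; rewrite -!nrmE -rmorphM lecR => /le_trans; apply.
by rewrite ler_wpM2r ?nrm_ge0 // ler_wpDr // ler_norm.
Qed.

Lemma bounded_idfun : bounded_operator (idfun : H -> H).
Proof. by split=> //; exists 1 => x; rewrite mul1r. Qed.

Lemma bounded0 : bounded_operator (0 : H -> H).
Proof.
split; first by move=> a u v /=; rewrite scaler0 addr0.
by exists 0 => x /=; rewrite normr0 mul0r.
Qed.

Lemma boundedD S T : bounded_operator S -> bounded_operator T ->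
  bounded_operator (S + T).
Proof.
move=> /boundedP[lS [M M0 hM]] /boundedP[lT [N N0 hN]].
apply/boundedP; split.
  by move=> a u v /=; rewrite !fctE lS lT scalerDr addrACA.
exists (M + N) => [|x]; first exact: addr_gt0.
by rewrite mulrDl (le_trans (nrmD _ _)) // lerD.
Qed.

Lemma boundedZ a T : bounded_operator T -> bounded_operator (a *: T).
Proof.
move=> /boundedP[lT [M M0 hM]]; apply/boundedP; split.
  by move=> b u v /=; rewrite !fctE lT scalerDr !scalerA mulrC.
have a0 : 0 <= complex.Re `|a| by rewrite -ler0c RRe_real ?ger0_real.
exists (complex.Re `|a| * M + 1) => [|x].
  by apply: ltr_wpDl; rewrite // mulr_ge0 // ltW.
rewrite nrmZ mulrDl mul1r -mulrA ler_wpDr ?nrm_ge0 //.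
by rewrite ler_wpM2l.
Qed.

Lemma boundedN T : bounded_operator T -> bounded_operator (- T).
Proof. by move=> /(boundedZ (-1)); rewrite scaleN1r. Qed.

Lemma boundedB S T : bounded_operator S -> bounded_operator T ->
  bounded_operator (S - T).
Proof. by move=> bS bT; apply: boundedD => //; apply: boundedN. Qed.

Lemma bounded_comp S T : bounded_operator S -> bounded_operator T ->
  bounded_operator (S \o T).
Proof.
move=> /boundedP[lS [M M0 hM]] /boundedP[lT [N N0 hN]].
apply/boundedP; split; first by move=> a u v /=; rewrite lT lS.
exists (M * N) => [|x]; first exact: mulr_gt0.
by rewrite (le_trans (hM _)) // -mulrA ler_pM2l.
Qed.

(** Banach's fixed point theorem. The whole orbit stays within [D] of its
    starting point, because D = |u 0 - u 1| + r D; applying [g] repeatedly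
    shrinks this bound geometrically. *)
Lemma contraction_fixed (g : H -> H) (r : R) : 0 <= r < 1 ->
  (forall x y, nrm (g x - g y) <= r * nrm (x - y)) -> exists x, g x = x.
Proof.
move=> /andP[r0 r1] hg; pose u n := iter n g 0.
pose D := nrm (u 0%N - u 1%N) / (1 - r).
have r1' : 0 < 1 - r by rewrite subr_gt0.
have D0 : 0 <= D by rewrite divr_ge0 ?nrm_ge0 // ltW.
have shift n m k : nrm (u (n + m)%N - u (n + k)%N) <= r ^+ n * nrm (u m - u k).
  elim: n => [|n IH]; first by rewrite expr0 mul1r.
  rewrite !addSn /= exprS -mulrA; apply: le_trans (hg _ _) _.
  by rewrite ler_wpM2l.
have far m : nrm (u 0%N - u m) <= D.
  elim: m => [|m IH]; first by rewrite subrr nrm0.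
  apply: le_trans (nrm_dist (u 1%N) _ _) _.
  have -> : nrm (u 0%N - u 1%N) = D * (1 - r) by rewrite divfK ?gt_eqF.
  have := shift 1%N 0%N m; rewrite add1n expr1 => h; nra.
have cau n m : (n <= m)%N -> nrm (u n - u m) <= r ^+ n * D.
  move=> /subnKC <-; have := shift n 0%N (m - n)%N; rewrite addn0 => /le_trans.
  by apply; rewrite ler_wpM2l ?exprn_ge0.
have small (e : R) : 0 < e -> exists N, r ^+ N * D <= e.
  move=> e0.
  have /cvgrPdist_le/(_ (e / (D + 1))) : (fun n => r ^+ n) @ \oo --> 0.
    by apply: cvg_expr; rewrite ger0_norm.
  have D1 : 0 < D + 1 by rewrite ltr_wpDl.
  move=> /(_ (divr_gt0 e0 D1)) [N _ /(_ N)] /=; rewrite leqnn => /(_ isT).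
  rewrite sub0r normrN ger0_norm ?exprn_ge0 // => h; exists N.
  have : r ^+ N * (D + 1) <= e by rewrite -ler_pdivlMr.
  by apply: le_trans; rewrite ler_wpM2l ?exprn_ge0 // lerDl.
have small2 (e : R) : 0 < e -> exists N, forall m n, (N <= m)%N -> (N <= n)%N ->
    nrm (u m - u n) <= e.
  move=> e0; have [N hN] := small (e / 2) ltac:(lra); exists N => m n Nm Nn.
  apply: le_trans (nrm_dist (u N) _ _) _; rewrite nrm_distC.
  by rewrite [e]splitr lerD // (le_trans _ hN) // cau.
have [l hl] := hilbert_complete small2.
exists l; apply/eqP; rewrite -subr_eq0; apply/eqP/nrm_eq0/eqP.
rewrite eq_le nrm_ge0 andbT; apply/ler_addgt0Pl => e e0.
have [N hN] := hl (e / 2) ltac:(lra).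
apply: le_trans (nrm_dist (u N.+1) _ _) _.
rewrite addr0 [leRHS]splitr lerD ?hN //.
apply: le_trans (hg l (u N)) _; rewrite nrm_distC.
by apply: le_trans (hN _ (leqnn N)); rewrite ler_piMl ?nrm_ge0 // ltW.
Qed.

Lemma coercive_lower T c x : 0 < c ->
  c * nrm x ^+ 2 <= rdot (T x) x -> c * nrm x <= nrm (T x).
Proof.
move=> c0 h; have := le_trans h (rdot_le _ _); rewrite expr2 mulrA.
have [->|nx] := eqVneq (nrm x) 0; first by rewrite !mulr0 nrm_ge0.
by rewrite ler_pM2r // lt_neqAle eq_sym nx nrm_ge0.
Qed.

(** To solve T x = y, iterate x |-> x - s (T x - y). Expanding the square,
    |d - s T d|^2 <= (1 - 2 s c + s^2 M^2) |d|^2, and s = c / M^2 makes the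
    factor equal to 1 - c^2 / M^2. *)
Lemma lax_milgram T c : bounded_operator T -> 0 < c ->
  (forall x, c * nrm x ^+ 2 <= rdot (T x) x) -> invertible_operator T.
Proof.
move=> /boundedP[lT [M0 M00 hM0]] c0 hT.
(* adding [c] ensures [c <= M], so that 1 - c^2 / M^2 is nonnegative *)
pose M := M0 + c; have M_gt0 : 0 < M by rewrite addr_gt0.
have hM x : nrm (T x) <= M * nrm x.
  by rewrite (le_trans (hM0 x)) // ler_wpM2r ?nrm_ge0 // lerDl ltW.
have injT : injective T.
  move=> x y Txy; apply/eqP; rewrite -subr_eq0; apply/eqP/nrm_eq0/eqP.
  rewrite eq_le nrm_ge0 andbT -(ler_pM2l c0) mulr0.
  by rewrite (le_trans (coercive_lower c0 (hT _))) // linB // Txy subrr nrm0.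
pose s := c / M ^+ 2; have s0 : 0 < s by rewrite divr_gt0 ?exprn_gt0.
pose r2 := 1 - c ^+ 2 / M ^+ 2.
have r2_ge0 : 0 <= r2.
  rewrite subr_ge0 ler_pdivrMr ?exprn_gt0 // mul1r ler_pXn2r ?nnegrE ?ltW //.
  by rewrite ltrDr.
have r2_lt1 : r2 < 1 by rewrite ltrBlDr ltrDl divr_gt0 ?exprn_gt0.
have surj y : exists x, T x = y.
  pose g x := x - s%:C *: (T x - y).
  have [||x gx] := @contraction_fixed g (Num.sqrt r2).
  - by rewrite sqrtr_ge0 -(@sqrtr1 R) ltr_sqrt.
  - move=> x x'; rewrite -ler_sqr ?nnegrE ?mulr_ge0 ?sqrtr_ge0 ?nrm_ge0 //.
    rewrite exprMn sqr_sqrtr //.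
    have -> : g x - g x' = (x - x') - s%:C *: T (x - x').
      rewrite /g (linB lT) !scalerBr !opprB [_ - x']addrC addrACA.
      congr (_ + _).
      by rewrite addrC subrKA.
    move: (x - x') => d; rewrite -rdotxx rdotBl !rdotBr !rdotZl !rdotZr !rdotxx.
    rewrite [rdot d _]rdotC.
    have h1 := hT d; have h2 := hM d.
    have h3 : nrm (T d) ^+ 2 <= M ^+ 2 * nrm d ^+ 2.
      rewrite -exprMn ler_pXn2r // nnegrE ?nrm_ge0 //.
      by rewrite mulr_ge0 ?nrm_ge0 // ltW.
    have e1 : s * M ^+ 2 = c by rewrite divfK ?gt_eqF ?exprn_gt0.
    have e2 : c ^+ 2 / M ^+ 2 = s * c by rewrite /s; ring.
    have h4 : s * (s * nrm (T d) ^+ 2) <= s * (c * nrm d ^+ 2).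
      by rewrite ler_pM2l // -e1 -mulrA ler_pM2l.
    have h5 : s * (c * nrm d ^+ 2) <= s * rdot (T d) d by rewrite ler_pM2l.
    by rewrite /r2 e2; lra.
  exists x; apply/eqP; rewrite -subr_eq0; move: gx; rewrite /g => /eqP.
  rewrite -subr_eq0 addrAC subrr sub0r oppr_eq0 scaler_eq0 => /orP[|//].
  by rewrite (inj_eq (@complexI R) _ 0) gt_eqF.
have [S TS] := choice surj.
have ST : cancel T S by move=> x; apply: injT; rewrite TS.
exists S; split=> //; apply/boundedP; split.
  by move=> a u v; apply: injT; rewrite lT !TS.
exists c^-1 => [|y]; first by rewrite invr_gt0.
by rewrite ler_pdivlMl // -[in leRHS](TS y) coercive_lower.
Qed.

Lemma invertible_comp S T : invertible_operator S -> invertible_operator T ->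
  invertible_operator (S \o T).
Proof.
move=> [S' [bS' SS' S'S]] [T' [bT' TT' T'T]]; exists (T' \o S'); split.
- exact: bounded_comp.
- exact: can_comp.
- exact: can_comp.
Qed.

Lemma invertible_unscale a T : linear T -> a != 0 ->
  invertible_operator (a *: T) -> invertible_operator T.
Proof.
move=> lT a0 [S [bS h1 h2]]; exists (a *: S); split.
- exact: boundedZ.
- move=> x; rewrite fctE -(linZ bS.1); exact: h1.
- by move=> x; rewrite fctE (linZ lT); exact: h2.
Qed.

End Operators.

(** * Self-adjoint operators and their spectrum *)

Section SelfAdjoint.
Context {R : realType} {H : hilbertType R}.
Implicit Types (x y : H) (z c : R[i]) (p q : {poly R[i]}) (S T : H -> H).

Lemma sa_rdot T x y : self_adjoint T -> rdot (T x) y = rdot x (T y).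
Proof. by move=> [_ sT]; rewrite /rdot sT. Qed.

Lemma sa_inner_real T x : self_adjoint T -> inner (T x) x = (rdot (T x) x)%:C.
Proof.
move=> [_ sT]; have := innerC (T x) x; rewrite -sT /rdot.
case: (inner (T x) x) => a b [] /eqP.
by rewrite -addr_eq0 -mulr2n mulrn_eq0 => /eqP ->.
Qed.

Lemma positiveP T : positive_operator T <->
  self_adjoint T /\ forall x, 0 <= rdot (T x) x.
Proof.
split=> -[sT h]; split=> // x; have := h x.
  by rewrite sa_inner_real // lecR.
by rewrite sa_inner_real // lecR.
Qed.

Lemma sa_of_rdot T : bounded_operator T ->
  (forall x y, rdot (T x) y = rdot x (T y)) -> self_adjoint T.
Proof.
move=> bT h; split=> // x y; apply: inner_ext => a.
by rewrite -(linZ bT.1) h.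
Qed.

Lemma sa_idfun : self_adjoint (idfun : H -> H).
Proof. by split=> //; exact: bounded_idfun. Qed.

Lemma saD S T : self_adjoint S -> self_adjoint T -> self_adjoint (S + T).
Proof.
move=> sS sT; apply: sa_of_rdot; first exact: boundedD sS.1 sT.1.
by move=> x y; rewrite !fctE rdotDl rdotDr !sa_rdot.
Qed.

Lemma saZ (a : R) T : self_adjoint T -> self_adjoint (a%:C *: T).
Proof.
move=> sT; apply: sa_of_rdot; first exact: boundedZ sT.1.
by move=> x y; rewrite !fctE rdotZl rdotZr sa_rdot.
Qed.

Lemma saB S T : self_adjoint S -> self_adjoint T -> self_adjoint (S - T).
Proof.
by move=> sS /(saZ (-1)); rewrite rmorphN1 scaleN1r; exact: saD.
Qed.

Lemma invertible_scale a T : bounded_operator T -> a != 0 ->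
  invertible_operator T -> invertible_operator (a *: T).
Proof.
move=> bT a0 [S [bS h1 h2]]; exists (a^-1 *: S); split.
- exact: boundedZ.
- by move=> x; rewrite !fctE (linZ bS.1) scalerA mulVf // scale1r h1.
- by move=> x; rewrite !fctE (linZ bT.1) scalerA mulfV // scale1r h2.
Qed.

(** The hypothesis says that w (z - T) is coercive; the factor [w] turns
    the numerical range of z - T into the right half-plane. *)
Lemma coercive_notin_spectrum T z (w : R[i]) (c : R) :
  bounded_operator T -> w != 0 -> 0 < c ->
  (forall x, c * nrm x ^+ 2 <=
             complex.Re (w * (z * (nrm x ^+ 2)%:C - inner (T x) x))) ->
  ~ spectrum T z.
Proof.
move=> bT w0 c0 h; apply.
have b : bounded_operator (z *: (idfun : H -> H) - T).
  by apply: boundedB => //; apply: boundedZ; exact: bounded_idfun.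
apply: (@invertible_unscale _ _ w) => //; first exact: b.1.
apply: (lax_milgram _ c0); first exact: boundedZ.
move=> x; apply: le_trans (h x) _; rewrite /rdot !fctE linearZl_LR /=.
by rewrite linearBl linearZl_LR /= inner_norm -nrmE rmorphXn.
Qed.

(** For z = u + iv with v != 0, multiplying by -iv makes z - T coercive,
    since the quadratic form of T is real. *)
Lemma sa_spectrum_real T z : self_adjoint T -> spectrum T z ->
  z = (complex.Re z)%:C.
Proof.
move=> sT; case: z => u v; have [->//|v0] := eqVneq v 0.
move=> /coercive_notin_spectrum -/(_ (0 +i* (- v)) (v ^+ 2)) [].
- exact: sT.1.
- by rewrite eq_complex /= oppr_eq0 (negbTE v0) andbF.
- by rewrite exprn_even_gt0.
- by move=> x; rewrite sa_inner_real //=; set n := nrm x ^+ 2; lra.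
Qed.

Lemma spectrum_ge T (m t : R) : self_adjoint T ->
  (forall x, m * nrm x ^+ 2 <= rdot (T x) x) -> spectrum T t%:C -> m <= t.
Proof.
move=> sT hm; rewrite leNgt => h; apply/negP => tm; move: h.
apply: (@coercive_notin_spectrum T t%:C (-1) (m - t)); first exact: sT.1.
- by rewrite oppr_eq0 oner_eq0.
- by rewrite subr_gt0.
move=> x; rewrite sa_inner_real // mulN1r /=; have := hm x.
by set n := nrm x ^+ 2; lra.
Qed.

Lemma spectrum_le T (M t : R) : self_adjoint T ->
  (forall x, rdot (T x) x <= M * nrm x ^+ 2) -> spectrum T t%:C -> t <= M.
Proof.
move=> sT hM; rewrite leNgt => h; apply/negP => tM; move: h.
apply: (@coercive_notin_spectrum T t%:C 1 (t - M)); first exact: sT.1.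
- by rewrite oner_eq0.
- by rewrite subr_gt0.
move=> x; rewrite sa_inner_real // mul1r /=; have := hM x.
by set n := nrm x ^+ 2; lra.
Qed.

(** Positivity of the quadratic form at x - P x / M gives
    |P x|^2 <= M <P x, x>, and |x| <= N |P x| for a bound N of the inverse. *)
Lemma positive_invertible P : self_adjoint P -> (forall x, 0 <= rdot (P x) x) ->
  invertible_operator P ->
  exists2 d : R, 0 < d & forall x, d * nrm x ^+ 2 <= rdot (P x) x.
Proof.
move=> sP P0 [Q [bQ PQ _]].
have [lP [M M0 hM]] := (boundedP P).1 sP.1.
have [_ [N N0 hN]] := (boundedP Q).1 bQ.
have key x : nrm (P x) ^+ 2 <= M * rdot (P x) x.
  have := P0 (x - (M^-1)%:C *: P x).
  rewrite (linB lP) (linZ lP) rdotBl !rdotBr !rdotZl !rdotZr !rdotxx.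
  rewrite (sa_rdot (P x) x sP) rdotxx.
  have h1 : rdot (P (P x)) (P x) <= M * nrm (P x) ^+ 2.
    apply: le_trans (rdot_le _ _) _; rewrite expr2 mulrA.
    by rewrite ler_wpM2r ?nrm_ge0.
  have Mi : 0 < M^-1 by rewrite invr_gt0.
  have h2 : M^-1 * (M^-1 * rdot (P (P x)) (P x)) <= M^-1 * nrm (P x) ^+ 2.
    by rewrite ler_pM2l // ler_pdivrMl.
  move=> h3; rewrite -ler_pdivrMl //; lra.
exists (N ^+ 2 * M)^-1; first by rewrite invr_gt0 mulr_gt0 ?exprn_gt0.
move=> x; rewrite ler_pdivrMl ?mulr_gt0 ?exprn_gt0 // -mulrA.
have hx : nrm x ^+ 2 <= N ^+ 2 * nrm (P x) ^+ 2.
  rewrite -exprMn ler_pXn2r ?nnegrE ?nrm_ge0 ?mulr_ge0 ?nrm_ge0 ?(ltW N0) //.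
  by rewrite -{1}(PQ x).
by apply: le_trans hx _; rewrite ler_pM2l ?exprn_gt0.
Qed.

End SelfAdjoint.

(** * Polynomials of an operator *)

Section Polynomials.
Context {R : realType} {H : hilbertType R}.
Implicit Types (x : H) (z c : R[i]) (p q : {poly R[i]}) (T : H -> H).

(** Complex coefficients allow a polynomial to be split into linear factors. *)
Definition cpoly_operator (q : {poly R[i]}) T : H -> H :=
  fun x => \sum_(i < size q) q`_i *: iter i T x.

Lemma cpoly_operatorE n q T x : (size q <= n)%N ->
  cpoly_operator q T x = \sum_(i < n) q`_i *: iter i T x.
Proof.
move=> qn; rewrite /cpoly_operator.
rewrite (big_ord_widen n (fun i => q`_i *: iter i T x)) //.
rewrite big_mkcond /=; apply: eq_bigr => i _; case: ltnP => // qi.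
by rewrite nth_default // scale0r.
Qed.

Lemma cpoly_operatorMXaddC q c T :
  cpoly_operator (q * 'X + c%:P) T =
  cpoly_operator q T \o T + c *: (idfun : H -> H).
Proof.
apply/funext => x; rewrite !fctE /= (@cpoly_operatorE (size q).+1); last first.
  by rewrite size_MXaddC; case: ifP.
rewrite big_ord_recl addrC /= coefD coefMX coefC eqxx add0r; congr (_ + _).
rewrite /cpoly_operator; apply: eq_bigr => i _.
by rewrite /bump /= add1n coefD coefMX coefC /= addr0 -iterSr.
Qed.

Lemma cpoly_operator0 T : cpoly_operator 0 T = 0.
Proof. by apply/funext => x; rewrite /cpoly_operator size_poly0 big_ord0. Qed.

Lemma cpoly_operatorC c T : cpoly_operator c%:P T = c *: (idfun : H -> H).
Proof.
have -> : c%:P = 0 * 'X + c%:P by rewrite mul0r add0r.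
rewrite cpoly_operatorMXaddC cpoly_operator0.
by apply/funext => x; rewrite !fctE add0r.
Qed.

Lemma cpoly_operatorD p q T :
  cpoly_operator (p + q) T = cpoly_operator p T + cpoly_operator q T.
Proof.
apply/funext => x; rewrite !fctE; pose n := maxn (size p) (size q).
rewrite !(@cpoly_operatorE n) ?leq_maxl ?leq_maxr ?size_polyD // -big_split /=.
by apply: eq_bigr => i _; rewrite coefD scalerDl.
Qed.

Lemma cpoly_operatorZ c q T :
  cpoly_operator (c *: q) T = c *: cpoly_operator q T.
Proof.
apply/funext => x; rewrite !fctE (@cpoly_operatorE (size q)) ?size_scale_leq //.
by rewrite scaler_sumr; apply: eq_bigr => i _; rewrite coefZ scalerA.
Qed.

Lemma bounded_cpoly_operator q T :
  bounded_operator T -> bounded_operator (cpoly_operator q T).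
Proof.
move=> bT; elim/poly_ind: q => [|q c IH].
  by rewrite cpoly_operator0; exact: bounded0.
rewrite cpoly_operatorMXaddC; apply: boundedD; first exact: bounded_comp.
by apply: boundedZ; exact: bounded_idfun.
Qed.

Lemma cpoly_operatorM p q T : bounded_operator T ->
  cpoly_operator (p * q) T = cpoly_operator p T \o cpoly_operator q T.
Proof.
move=> bT; elim/poly_ind: q => [|q c IH].
  rewrite mulr0 !cpoly_operator0; apply/funext => x /=.
  by rewrite (lin0 (bounded_cpoly_operator p bT).1).
have -> : p * (q * 'X + c%:P) = (p * q) * 'X + 0%:P + c *: p.
  by rewrite addr0 mulrDr mulrA -mul_polyC [p * c%:P]mulrC.
rewrite cpoly_operatorD cpoly_operatorZ !cpoly_operatorMXaddC IH.
apply/funext => x /=.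
have lp := (bounded_cpoly_operator p bT).1.
by rewrite !fctE /= scale0r addr0 (linD lp) (linZ lp).
Qed.

(** Over the complex numbers q(T) is, up to a nonzero scalar, the product of
    the operators T - z over the roots z of [q]. *)
Lemma cpoly_operator_invertible q T : bounded_operator T -> q != 0 ->
  (forall z, root q z -> ~ spectrum T z) ->
  invertible_operator (cpoly_operator q T).
Proof.
move=> bT q0 hq; have [r qE] := closed_field_poly_normal q.
have lq : lead_coef q != 0 by rewrite lead_coef_eq0.
have hr z : z \in r -> ~ spectrum T z.
  by move=> zr; apply: hq; rewrite qE rootZ // root_prod_XsubC.
rewrite qE cpoly_operatorZ; apply: invertible_scale => //.
  exact: bounded_cpoly_operator.
elim: r {qE} hr => [|z r IH] hr.
  rewrite big_nil -polyC1 cpoly_operatorC scale1r; exists idfun; split=> //.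
  exact: bounded_idfun.
rewrite big_cons cpoly_operatorM //; apply: invertible_comp; last first.
  by apply: IH => t tr; apply: hr; rewrite inE tr orbT.
have -> : 'X - z%:P = 1%:P * 'X + (- z)%:P by rewrite polyCN mul1r.
rewrite cpoly_operatorMXaddC cpoly_operatorC scale1r.
have /contrapT : ~ spectrum T z by apply: hr; rewrite mem_head.
move=> /(@invertible_scale _ _ (-1)); rewrite scaleN1r => h.
have -> : idfun \o T + - z *: (idfun : H -> H) = - (z *: (idfun : H -> H) - T).
  by apply/funext => x; rewrite !fctE /= opprB scaleNr.
apply: h; last by rewrite oppr_eq0 oner_eq0.
by apply: boundedB => //; apply: boundedZ; exact: bounded_idfun.
Qed.

End Polynomials.

Section SpectralEstimates.
Context {R : realType} {H : hilbertType R}.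
Implicit Types (x y : H) (p q : {poly R}) (S T : H -> H).

Lemma poly_operatorE q T :
  poly_operator q T = cpoly_operator (map_poly (real_complex R) q) T.
Proof.
apply/funext => x.
rewrite /poly_operator /cpoly_operator fct_sumE size_map_poly.
by apply: eq_bigr => i _; rewrite coef_map.
Qed.

Lemma poly_operatorC c T : poly_operator c%:P T = c%:C *: (idfun : H -> H).
Proof. by rewrite poly_operatorE map_polyC cpoly_operatorC. Qed.

Lemma poly_operatorX T : poly_operator 'X T = T.
Proof.
rewrite poly_operatorE map_polyX.
have -> : 'X = 1%:P * 'X + 0%:P :> {poly R[i]} by rewrite mul1r addr0.
rewrite cpoly_operatorMXaddC cpoly_operatorC; apply/funext => x.
by rewrite !fctE /= scale1r scale0r addr0.
Qed.

Lemma poly_operatorD p q T :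
  poly_operator (p + q) T = poly_operator p T + poly_operator q T.
Proof. by rewrite !poly_operatorE rmorphD cpoly_operatorD. Qed.

Lemma poly_operatorZ c q T :
  poly_operator (c *: q) T = c%:C *: poly_operator q T.
Proof. by rewrite !poly_operatorE map_polyZ cpoly_operatorZ. Qed.

Lemma poly_operatorB p q T :
  poly_operator (p - q) T = poly_operator p T - poly_operator q T.
Proof.
by rewrite poly_operatorD -scaleN1r poly_operatorZ rmorphN1 scaleN1r.
Qed.

Lemma poly_operatorM p q T : bounded_operator T ->
  poly_operator (p * q) T = poly_operator p T \o poly_operator q T.
Proof. by move=> bT; rewrite !poly_operatorE rmorphM cpoly_operatorM. Qed.

Lemma sa_poly_operator q T : self_adjoint T -> self_adjoint (poly_operator q T).
Proof.
move=> sT; split.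
  by rewrite poly_operatorE; exact: bounded_cpoly_operator sT.1.
have sI i x y : inner (iter i T x) y = inner x (iter i T y).
  by elim: i x y => //= i IH x y; rewrite sT.2 IH -iterSr iterS.
move=> x y; rewrite /poly_operator !fct_sumE linear_sumlz linear_sumr.
apply: eq_bigr => i _; rewrite !fctE linearZl_LR linearZr_LR /= sI.
by congr (_ * _); exact: (esym (conjc_real _)).
Qed.

(** Take for m the best lower bound. If S - m were invertible, it would be
    bounded below by some d > 0, being positive, and m + d would be a better
    bound. The vector [x0] makes the set of lower bounds bounded above. *)
Lemma sa_lower_bound_in_spectrum S x0 : self_adjoint S -> x0 <> 0 ->
  exists2 m, spectrum S m%:C & forall x, m * nrm x ^+ 2 <= rdot (S x) x.
Proof.
move=> sS x00.
pose E := [set l : R | forall x, l * nrm x ^+ 2 <= rdot (S x) x].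
have ratio x : x <> 0 -> ubound E (rdot (S x) x / nrm x ^+ 2).
  move=> nx l El; rewrite ler_pdivlMr; first exact: El.
  by rewrite exprn_gt0 // lt_neqAle nrm_ge0 andbT eq_sym; apply/eqP => /nrm_eq0.
have [lS [M M0 hM]] := (boundedP S).1 sS.1.
have E0 : E !=set0.
  exists (- M) => x; have := rdot_abs (S x) x; rewrite ler_norml => /andP[h _].
  apply: le_trans h; rewrite mulNr lerN2 expr2 mulrA.
  by rewrite ler_wpM2r ?nrm_ge0.
have Esup : has_sup E.
  by split=> //; exists (rdot (S x0) x0 / nrm x0 ^+ 2); exact: ratio.
set m := sup E.
have mE x : m * nrm x ^+ 2 <= rdot (S x) x.
  have [->|nx] := pselect (x = 0).
    by rewrite nrm0 expr0n mulr0 (lin0 lS) /rdot linear0l.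
  rewrite -ler_pdivlMr; first by apply: ge_sup => //; exact: ratio.
  by rewrite exprn_gt0 // lt_neqAle nrm_ge0 andbT eq_sym; apply/eqP => /nrm_eq0.
exists m => //.
pose P := S - m%:C *: (idfun : H -> H).
have sP : self_adjoint P by apply: saB => //; apply: saZ; exact: sa_idfun.
have PE x : rdot (P x) x = rdot (S x) x - m * nrm x ^+ 2.
  by rewrite /P !fctE rdotBl rdotZl rdotxx.
move=> /(@invertible_scale _ _ (-1)); rewrite scaleN1r opprB => inv.
have [|||d d0 hd] := @positive_invertible _ _ P.
- exact: sP.
- by move=> x; rewrite PE subr_ge0.
- apply: inv; last by rewrite oppr_eq0 oner_eq0.
  by apply: boundedB; [apply: boundedZ; exact: bounded_idfun|exact: sS.1].
have : E (m + d).
  by move=> x; have := hd x; rewrite PE mulrDl; lra.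
by move=> /(ub_le_sup Esup.2); rewrite -/m; lra.
Qed.

(** The lower bound m of q(T) given by [sa_lower_bound_in_spectrum] is a value
    q(t) at a point t of the spectrum of [T]: otherwise no root of q - m would
    lie in the spectrum, and q(T) - m would be invertible. *)
Lemma spectral_lower q T c : self_adjoint T ->
  (forall t : R, spectrum T t%:C -> c <= q.[t]) ->
  forall x, c * nrm x ^+ 2 <= rdot (poly_operator q T x) x.
Proof.
move=> sT hq x; have sS := sa_poly_operator q sT.
have [->|x0] := pselect (x = 0).
  by rewrite nrm0 expr0n mulr0 (lin0 sS.1.1) /rdot linear0l.
have [m Sm hm] := sa_lower_bound_in_spectrum sS x0.
apply: le_trans (hm x); rewrite ler_wpM2r ?sqr_ge0 //.
(* if q is the constant m, every point of the spectrum gives q(t) = m *)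
have [q0|q0] := eqVneq (q - m%:P) 0.
  have [t Tt _] := sa_lower_bound_in_spectrum sT x0.
  by move/eqP: q0 (hq t Tt); rewrite subr_eq0 => /eqP ->; rewrite hornerC.
have [//|nt] := pselect (exists2 t : R, spectrum T t%:C & q.[t] = m).
  by move=> [t Tt <-]; exact: hq.
case: Sm; rewrite -opprB -(poly_operatorC m T) -poly_operatorB -scaleN1r.
apply: invertible_scale; first exact: (sa_poly_operator _ sT).1.
  by rewrite oppr_eq0 oner_eq0.
rewrite poly_operatorE; apply: cpoly_operator_invertible; first exact: sT.1.
  by rewrite map_poly_eq0.
move=> z rz Tz; apply: nt; move: rz; have zr := sa_spectrum_real sT Tz.
rewrite zr in Tz *; rewrite fmorph_root rootE !hornerE subr_eq0 => /eqP rz.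
by exists (complex.Re z).
Qed.

(** |q(T) x|^2 = <q(T)^2 x, x>, and e^2 - q^2 >= 0 on the spectrum. *)
Lemma spectral_norm q T e : self_adjoint T -> 0 <= e ->
  (forall t : R, spectrum T t%:C -> `|q.[t]| <= e) ->
  forall x, nrm (poly_operator q T x) <= e * nrm x.
Proof.
move=> sT e0 hq x; have sS := sa_poly_operator q sT.
have := @spectral_lower ((e ^+ 2)%:P - q * q) T 0 sT _ x.
rewrite mul0r poly_operatorB poly_operatorC (poly_operatorM _ _ sT.1).
rewrite !fctE rdotBl rdotZl rdotxx /= (sa_rdot _ _ sS) rdotxx => h.
rewrite -ler_sqr ?nnegrE ?mulr_ge0 ?nrm_ge0 // exprMn -subr_ge0 h //.
move=> t /hq; rewrite !hornerE -expr2 subr_ge0.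
rewrite -(@real_normK _ q.[t]) ?num_real //.
by move=> ht; rewrite ler_pXn2r ?nnegrE.
Qed.

End SpectralEstimates.

(** * Functional calculus *)

Lemma uniform_cvgP (R : realType) (A : set R) (F : nat -> R -> R) (f : R -> R) :
  {uniform A, F @ \oo --> f} <->
  forall e : R, 0 < e ->
    \forall n \near \oo, forall t, A t -> `|f t - F n t| <= e.
Proof.
split=> [Ff e e0|h P /uniform_nbhs[E [entE subP]]].
  apply: (Ff [set g | forall t, A t -> `|f t - g t| <= e]).
  apply/uniform_nbhs; exists [set xy | ball xy.1 e xy.2]; split.
    by rewrite -entourage_ballE; exists e.
  by move=> g /= hg t /hg; rewrite -ball_normE /= => /ltW.
move: entE; rewrite -entourage_ballE => -[e /= e0 subE].
have e2 : 0 < e / 2 by lra.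
have [N _ hN] := h _ e2.
exists N => // n Nn; apply: subP => t At; apply: subE => /=.
by rewrite -ball_normE /=; apply: le_lt_trans (hN n Nn t At) _; lra.
Qed.

Lemma le0_of_harmonic (R : realType) (c K : R) :
  (forall n, c <= K * harmonic n) -> c <= 0.
Proof.
move=> h; have : (fun n => K * harmonic n) @ \oo --> K * 0.
  by apply: cvgMr; exact: cvg_harmonic.
rewrite mulr0 => hK; rewrite -(cvg_lim _ hK) //; apply: limr_ge.
  by apply/cvg_ex; exists 0.
exact: nearW.
Qed.

Section Funcalc.
Context {R : realType} {H : hilbertType R}.
Implicit Types (x y : H) (p q : {poly R}) (S T : H -> H) (f : R -> R).

Lemma opnorm_set_sup T : bounded_operator T ->
  has_sup [set complex.Re `|T x| | x in [set x : H | `|x| <= 1]].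
Proof.
move=> /boundedP[lT [M M0 hM]]; split.
  by exists (complex.Re `|T 0|), 0 => //=; rewrite normr0.
exists M => _ [x /= x1 <-]; apply: le_trans (hM x) _.
by rewrite ler_piMr ?(ltW M0) // -lecR nrmE.
Qed.

Lemma opnorm_ge0 T : bounded_operator T -> 0 <= opnorm T.
Proof.
move=> bT; apply: (ub_le_sup (opnorm_set_sup bT).2).
by exists 0; rewrite /= ?normr0 // (lin0 bT.1) normr0.
Qed.

Lemma opnorm_bound T x : bounded_operator T -> nrm (T x) <= opnorm T * nrm x.
Proof.
move=> bT; have [/nrm_eq0 ->|nx] := eqVneq (nrm x) 0.
  by rewrite (lin0 bT.1) nrm0 mulr0.
have x0 : 0 < nrm x by rewrite lt_neqAle eq_sym nx nrm_ge0.
rewrite -ler_pdivrMr //; apply: (ub_le_sup (opnorm_set_sup bT).2).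
exists ((nrm x)^-1%:C *: x) => /=.
  by rewrite -nrmE nrmZr ger0_norm ?invr_ge0 ?nrm_ge0 // mulVf.
rewrite -/(nrm _) (linZ bT.1) nrmZr ger0_norm ?invr_ge0 ?nrm_ge0 //.
by rewrite mulrC.
Qed.

Lemma opnorm_le T e : 0 <= e -> (forall x, nrm (T x) <= e * nrm x) ->
  opnorm T <= e.
Proof.
move=> e0 h; apply: ge_sup.
  by exists (complex.Re `|T 0|), 0 => //=; rewrite normr0.
move=> _ [x /= x1 <-]; apply: le_trans (h x) _.
by rewrite ler_piMr // -lecR nrmE.
Qed.

(** A single polynomial close to [f] on the spectrum and with q(T) close to
    [S] is all that the order properties of f(T) need. *)
Lemma funcalc_approx T f S e :
  bounded_operator T -> is_funcalc T f S -> 0 < e ->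
  exists2 q, forall t : R, spectrum T t%:C -> `|f t - q.[t]| <= e
  & forall x, nrm (poly_operator q T x - S x) <= e * nrm x.
Proof.
move=> bT [bS [q [/uniform_cvgP qf /cvgrPdist_le qS]]] e0.
near \oo => n; exists (q n).
  by near: n; exact: qf.
have bQ : bounded_operator (poly_operator (q n) T - S).
  rewrite poly_operatorE; apply: boundedB => //.
  exact: bounded_cpoly_operator.
have h : opnorm (poly_operator (q n) T - S) <= e.
  have : `|0 - opnorm (poly_operator (q n) T - S)| <= e by near: n; exact: qS.
  by rewrite sub0r normrN ger0_norm // opnorm_ge0.
by move=> x; apply: le_trans (opnorm_bound x bQ) _; rewrite ler_wpM2r ?nrm_ge0.
Unshelve. all: by end_near. Qed.

Lemma sa_funcalc T f S : self_adjoint T -> is_funcalc T f S -> self_adjoint S.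
Proof.
move=> sT fS; apply: sa_of_rdot fS.1 _ => x y.
apply/eqP; rewrite -subr_eq0 -normr_eq0 eq_le normr_ge0 andbT.
apply/ler_addgt0Pl => e e0; rewrite addr0.
pose K := 2 * (nrm x * nrm y) + 1.
have K0 : 0 < K by rewrite ltr_wpDl ?mulr_ge0 ?nrm_ge0.
have [q _ hq] := funcalc_approx sT.1 fS (divr_gt0 e0 K0).
set d := e / K in hq.
have d0 : 0 < d by rewrite divr_gt0.
have -> : rdot (S x) y - rdot x (S y) =
    rdot x (poly_operator q T y - S y) - rdot (poly_operator q T x - S x) y.
  by rewrite rdotBr rdotBl (sa_rdot _ _ (sa_poly_operator q sT)); ring.
apply: le_trans (ler_normB _ _) _.
have h1 := rdot_abs x (poly_operator q T y - S y).
have h2 := rdot_abs (poly_operator q T x - S x) y.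
have h3 := ler_wpM2l (nrm_ge0 x) (hq y).
have h4 := ler_wpM2r (nrm_ge0 y) (hq x).
have -> : e = d * K by rewrite divfK // gt_eqF.
rewrite /K; lra.
Qed.

(** The factor [s], used with values 1 and -1, lets one statement serve for
    minorants and majorants of [f]. *)
Lemma funcalc_ge_poly T f S g (s : R) : self_adjoint T -> is_funcalc T f S ->
  (forall t : R, spectrum T t%:C -> g.[t] <= s * f t) ->
  forall x, rdot (poly_operator g T x) x <= s * rdot (S x) x.
Proof.
move=> sT fS hg x; apply/ler_addgt0Pl => e e0.
pose K := 2 * `|s| * nrm x ^+ 2 + 1.
have K0 : 0 < K by rewrite ltr_wpDl ?mulr_ge0 ?exprn_ge0 ?nrm_ge0.
have [q qf hq] := funcalc_approx sT.1 fS (divr_gt0 e0 K0).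
set d := e / K in qf hq.
have d0 : 0 < d by rewrite divr_gt0.
have := @spectral_lower _ _ (s *: q - g) T (- (`|s| * d)) sT _ x.
rewrite poly_operatorB poly_operatorZ !fctE rdotBl rdotZl => h.
have {}h := h _; have {}h : - (`|s| * d) * nrm x ^+ 2 <=
   s * rdot (poly_operator q T x) x - rdot (poly_operator g T x) x.
  apply: h => t Tt; rewrite hornerD hornerN hornerZ.
  have := hg t Tt; have := ler_wpM2l (normr_ge0 s) (qf t Tt).
  rewrite -normrM => h1; have := ler_norm (s * (f t - q.[t])); lra.
have h2 : s * rdot (poly_operator q T x) x - s * rdot (S x) x <=
    `|s| * d * nrm x ^+ 2.
  rewrite -mulrBr -rdotBl; apply: le_trans (ler_norm _) _.
  rewrite normrM -mulrA.
  rewrite ler_wpM2l //; apply: le_trans (rdot_abs _ _) _.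
  by rewrite expr2 mulrA ler_wpM2r ?nrm_ge0.
have -> : e = d * K by rewrite divfK // gt_eqF.
rewrite /K; lra.
Qed.

(** By [spectral_norm] the operators q_n(T) form a Cauchy sequence in operator
    norm, with rate 2/(n+1); the limit is built pointwise and inherits this
    rate. *)
Lemma funcalc_exists T f : self_adjoint T ->
  (forall e : R, 0 < e ->
    exists q, forall t : R, spectrum T t%:C -> `|f t - q.[t]| <= e) ->
  exists S, is_funcalc T f S.
Proof.
move=> sT hf.
have h0 n : 0 < harmonic n :> R by rewrite invr_gt0.
have [q hq] := choice (fun n => hf _ (h0 n)).
have hdec m n : (m <= n)%N -> harmonic n <= harmonic m :> R.
  by move=> mn; rewrite lef_pV2 ?posrE // ler_nat.
pose Q n := poly_operator (q n) T.
have lQ n : linear (Q n) by exact: (sa_poly_operator _ sT).1.1.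
have near0 (e : R) : 0 < e -> exists N, harmonic N <= e.
  move=> e0.
  have /cvgrPdist_le/(_ e e0)[N _ /(_ N (leqnn N)) h] := @cvg_harmonic R.
  by exists N; move: h; rewrite /= sub0r normrN ger0_norm // ltW.
have cau N m n x : (N <= m)%N -> (N <= n)%N ->
    nrm (Q m x - Q n x) <= 2 * harmonic N * nrm x.
  move=> Nm Nn.
  have := @spectral_norm _ _ (q m - q n) T (2 * harmonic N) sT _ _ x.
  rewrite poly_operatorB; apply; first by rewrite mulr_ge0 // ltW.
  move=> t Tt; rewrite hornerD hornerN.
  have -> : (q m).[t] - (q n).[t] =
      (f t - (q n).[t]) - (f t - (q m).[t]) by ring.
  apply: le_trans (ler_normB _ _) _.
  have := hq m t Tt; have := hq n t Tt.
  have := hdec _ _ Nm; have := hdec _ _ Nn.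
  lra.
have lim x : exists l, forall e : R, 0 < e -> exists N, forall n, (N <= n)%N ->
    nrm (Q n x - l) <= e.
  apply: hilbert_complete => e e0.
  have K0 : 0 < 2 * nrm x + 1 by rewrite ltr_wpDl ?mulr_ge0 ?nrm_ge0.
  have [N hN] := near0 _ (divr_gt0 e0 K0).
  exists N => m n Nm Nn; apply: le_trans (cau _ _ _ x Nm Nn) _.
  move: hN; rewrite ler_pdivlMr // mulrDr mulr1; have := h0 N; lra.
have [S hS] := choice lim.
have QS n x : nrm (Q n x - S x) <= 2 * harmonic n * nrm x.
  apply/ler_addgt0Pl => e e0; have [N hN] := hS x e e0.
  apply: le_trans (nrm_dist (Q (maxn N n) x) _ _) _; rewrite addrC lerD //.
    by rewrite hN // leq_maxl.
  by rewrite cau // leq_maxr.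
have lS : linear S.
  move=> a u v /=; apply/eqP; rewrite -subr_eq0; apply/eqP/nrm_eq0/eqP.
  rewrite eq_le nrm_ge0 andbT.
  apply: (@le0_of_harmonic _ _
    (2 * (nrm (a *: u + v) + complex.Re `|a| * nrm u + nrm v))) => n.
  have -> : S (a *: u + v) - (a *: S u + S v) =
     a *: (Q n u - S u) + (Q n v - S v) - (Q n (a *: u + v) - S (a *: u + v)).
    rewrite lQ scalerBr opprB.
    by rewrite [a *: _ - _ + _]addrACA -opprD [RHS]addrC subrKA.
  apply: le_trans (nrmD _ _) _; rewrite nrmN.
  have := nrmD (a *: (Q n u - S u)) (Q n v - S v); rewrite nrmZ.
  have a0 : 0 <= complex.Re `|a| by rewrite -ler0c RRe_real ?ger0_real.
  have := ler_wpM2l a0 (QS n u); have := QS n v; have := QS n (a *: u + v).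
  lra.
have bS : bounded_operator S.
  apply/boundedP; split=> //.
  have [_ [M M0 hM]] := (boundedP _).1 (sa_poly_operator (q 0%N) sT).1.
  exists (M + 2) => [|x]; first exact: addr_gt0.
  have -> : S x = Q 0%N x - (Q 0%N x - S x) by rewrite opprB addrC subrK.
  apply: le_trans (nrmD _ _) _; rewrite nrmN mulrDl lerD //; first exact: hM.
  have h01 : harmonic 0 = 1 :> R by exact: invr1.
  by have := QS 0%N x; rewrite h01 mulr1.
exists S; split=> //; exists q; split.
  apply/uniform_cvgP => e e0; have [N hN] := near0 e e0.
  exists N => // n Nn t Tt; apply: le_trans (hq n t Tt) _.
  exact: le_trans (hdec _ _ Nn) hN.
apply/cvgrPdist_le => e e0; have [N hN] := near0 (e / 2) ltac:(lra).
exists N => // n Nn; rewrite sub0r normrN ger0_norm; last first.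
  by apply: opnorm_ge0; apply: boundedB => //; exact: (sa_poly_operator _ sT).1.
apply: opnorm_le; first exact: ltW.
move=> x; rewrite !fctE; apply: le_trans (QS n x) _.
rewrite ler_wpM2r ?nrm_ge0 //.
have := hdec _ _ Nn; lra.
Qed.

End Funcalc.

(** * Increments of operator powers *)

Section PowerIncrement.
Context {R : realType} {H : hilbertType R}.
Implicit Types (x y : H) (S T A B : H -> H) (p d : R).

Lemma rdot_le_opnorm T x : bounded_operator T ->
  rdot (T x) x <= opnorm T * nrm x ^+ 2.
Proof.
move=> bT; apply: le_trans (rdot_le _ _) _; rewrite expr2 mulrA.
by rewrite ler_wpM2r ?nrm_ge0 // opnorm_bound.
Qed.

(** The spectrum lies in [d, |T|], where the power is a uniform limit of
    polynomials: for [p < 0] this needs [d > 0]. *)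
Lemma operator_pow_funcalc T p d :
  self_adjoint T -> 0 <= d -> (p < 0 -> 0 < d) ->
  (forall x, d * nrm x ^+ 2 <= rdot (T x) x) ->
  is_funcalc T (fun t => t `^ p) (operator_pow T p).
Proof.
move=> sT d0 pd hd; apply: xgetPex; apply: funcalc_exists => // e e0.
have sp t : spectrum T t%:C -> d <= t <= opnorm T.
  move=> Tt; rewrite (spectrum_ge sT hd Tt) (spectrum_le sT _ Tt) // => x.
  exact: rdot_le_opnorm sT.1.
have [p0|p0] := leP 0 p.
  have [q hq] := powR_approx (opnorm T) p0 e0; exists q => t /sp /andP[dt tT].
  by apply: hq; rewrite tT (le_trans d0).
have [q hq] := powR_approx_away0 p (opnorm T) (pd p0) e0.
by exists q => t /sp; exact: hq.
Qed.

(** With g(t) = k t + c chosen so that g(a) = a^p at a = |A|, the scalar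
    hypothesis says that the power and [g] compare in opposite ways on the
    spectrum of [A], to the left of a, and on that of [B], to the right of a.
    The sign [s] covers the two directions of the theorem at once. *)
Lemma operator_pow_increment A B p (k d s : R) :
  self_adjoint A -> self_adjoint B -> 0 <= d -> (p < 0 -> 0 < d) ->
  (forall x, d * nrm x ^+ 2 <= rdot (A x) x) ->
  (forall x, opnorm A * nrm x ^+ 2 <= rdot (B x) x) ->
  (forall u t, d <= u -> u <= t -> t <= opnorm B ->
     s * (k * (t - u)) <= s * (t `^ p - u `^ p)) ->
  [/\ self_adjoint (operator_pow A p), self_adjoint (operator_pow B p) &
   forall x, s * (k * (rdot (B x) x - rdot (A x) x)) <=
     s * (rdot (operator_pow B p x) x - rdot (operator_pow A p x) x)].
Proof.
move=> sA sB d0 pd hA hB hs.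
set a := opnorm A in hB; set b := opnorm B in hs.
have Aa x : rdot (A x) x <= a * nrm x ^+ 2 by exact: rdot_le_opnorm sA.1.
have Bb x : rdot (B x) x <= b * nrm x ^+ 2 by exact: rdot_le_opnorm sB.1.
have hBd x : d * nrm x ^+ 2 <= rdot (B x) x.
  by apply: le_trans (hB x); apply: le_trans (Aa x).
have fA := operator_pow_funcalc sA d0 pd hA.
have fB := operator_pow_funcalc sB d0 pd hBd.
split; [exact: sa_funcalc fA|exact: sa_funcalc fB|move=> x].
have sSA := sa_funcalc sA fA; have sSB := sa_funcalc sB fB.
(* a nonzero vector yields [d <= a <= b], which can fail when H = 0 *)
have [->|x0] := pselect (x = 0).
  by rewrite /rdot !linear0r !subrr mulr0.
have n0 : 0 < nrm x ^+ 2.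
  by rewrite exprn_gt0 // lt_neqAle nrm_ge0 andbT eq_sym; apply/eqP => /nrm_eq0.
have da : d <= a by rewrite -(ler_pM2r n0) (le_trans (hA x)).
have ab : a <= b by rewrite -(ler_pM2r n0) (le_trans (hB x)).
pose c := a `^ p - k * a; pose g := (k *: 'X + c%:P : {poly R}).
have gE (t : R) : g.[t] = k * t + c by rewrite /g !hornerE.
have gT T : rdot (poly_operator g T x) x = k * rdot (T x) x + c * nrm x ^+ 2.
  rewrite poly_operatorD poly_operatorZ poly_operatorX poly_operatorC !fctE.
  by rewrite rdotDl !rdotZl rdotxx.
have lowB := @funcalc_ge_poly _ _ B _ _ (s *: g) s sB fB _ x.
have lowA := @funcalc_ge_poly _ _ A _ _ (- s *: g) (- s) sA fA _ x.
move: lowA lowB; rewrite !poly_operatorZ !fctE !rdotZl !gT => lowA lowB.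
have {}lowB : s * (k * rdot (B x) x + c * nrm x ^+ 2) <=
    s * rdot (operator_pow B p x) x.
  apply: lowB => t Bt; rewrite hornerZ gE.
  have at' := spectrum_ge sB hB Bt; have tb := spectrum_le sB Bb Bt.
  by have := hs a t da at' tb; rewrite /c; lra.
have {}lowA : - s * (k * rdot (A x) x + c * nrm x ^+ 2) <=
    - s * rdot (operator_pow A p x) x.
  apply: lowA => t At; rewrite hornerZ gE.
  have dt := spectrum_ge sA hA At; have ta := spectrum_le sA Aa At.
  by have := hs t a dt ta ab; rewrite /c; lra.
lra.
Qed.

End PowerIncrement.

Theorem theorem2 (R : realType) (H : hilbertType R) (A B : H -> H)
    (hA : positive_operator A) (hB : positive_operator B)
    (hAB : operator_le ((opnorm A)%:C *: (idfun : H -> H)) B) (p : R) :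
  (0 <= p <= 1 ->
    operator_le ((p * opnorm B `^ (p - 1))%:C *: (B - A))
                (operator_pow B p - operator_pow A p)) /\
  (1 <= p \/ (p <= 0 /\ (p < 0 -> invertible_operator A)) ->
    operator_le (operator_pow B p - operator_pow A p)
                ((p * opnorm B `^ (p - 1))%:C *: (B - A))).
Proof.
have [sA A0] := (positiveP A).1 hA; have [sB _] := (positiveP B).1 hB.
have A0' x : 0 * nrm x ^+ 2 <= rdot (A x) x by rewrite mul0r.
have aB x : opnorm A * nrm x ^+ 2 <= rdot (B x) x.
  have [_ _ /positiveP[_ /(_ x)]] := hAB.
  by rewrite !fctE rdotBl rdotZl rdotxx subr_ge0.
set k := p * _; have sAB : self_adjoint (k%:C *: (B - A)) by apply/saZ/saB.
split=> [p01|hp].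
  have [|||sPA sPB h] :=
    @operator_pow_increment _ _ A B p k 0 1 sA sB _ _ A0' aB.
  - exact: lexx.
  - by move: p01 => /andP[p0 _]; rewrite ltNge p0.
  - by move=> u t u0 ut tb; rewrite !mul1r; exact: powR_increment_ge.
  have sP : self_adjoint (operator_pow B p - operator_pow A p) by exact: saB.
  split=> //; apply/positiveP; split; first exact: saB.
  by move=> x; have := h x; rewrite !fctE !rdotBl rdotZl rdotBl; lra.
have {}hp : (1 <= p \/ p <= 0) /\ (p < 0 -> invertible_operator A).
  case: hp => [p1|[p0 pA]]; last by split=> //; right.
  by split; [left|rewrite ltNge (le_trans ler01 p1)].
case: hp => hp pA.
have [d [d0 pd hd]] : exists d : R, [/\ 0 <= d, p < 0 -> 0 < d &
    forall x, d * nrm x ^+ 2 <= rdot (A x) x].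
  have [p0|p0] := leP 0 p; first by exists 0; split.
  have [d d0 hd] := positive_invertible sA A0 (pA p0).
  by exists d; split=> //; exact: ltW.
have [|sPA sPB h] :=
  @operator_pow_increment _ _ A B p k d (- 1) sA sB d0 pd hd aB.
  move=> u t du ut tb; rewrite !mulN1r lerN2.
  apply: powR_increment_le => //; last exact: le_trans du.
  by move=> /pd /lt_le_trans; apply.
have sP : self_adjoint (operator_pow B p - operator_pow A p) by exact: saB.
split=> //; apply/positiveP; split; first exact: saB.
by move=> x; have := h x; rewrite !fctE !rdotBl rdotZl rdotBl; lra.
Qed.
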